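(* Let $(H,\tau)$ be a non-discrete paratopological group and let $G$ be an infinite subgroup of $H$ (with the subspace topology) such that $G\cdot c_H(G)=H$. Then there is a paratopological group topology on $H$ transversal to $\tau$ in each of the following cases: (1) there is a paratopological group topology on $G$ transversal to $\tau\upharpoonright_G$; (2) $G$ is discrete (in the subspace topology) and non-minimal, i.e. the abstract group $G$ admits a non-discrete paratopological group topology.
   Context: A paratopological group is a group with a topology for which multiplication is jointly continuous (no separation axiom is assumed); such a topology is called a paratopological group topology. Two non-discrete topologies on a set are transversal if their union generates the discrete topology. $c_H(G)$ denotes the centralizer of $G$ in $H$. $\tau\upharpoonright_G$ is the subspace topology on $G$. *)

(* Defs.v *)
From HB Require Import structures.
From mathcomp Require Import all_boot.
From mathcomp Require Import all_classical all_reals topology.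

Set Implicit Arguments.
Unset Strict Implicit.
Unset Printing Implicit Defensive.

Local Open Scope classical_set_scope.
Local Open Scope group_scope.

(* A topology on [T] is an element of [Topological T], so that several
   topologies can live on the same carrier; [space t] is [T] endowed with [t]. *)
Definition space (T : Type) (t : Topological T) : topologicalType :=
  Topological.Pack t.

Definition discrete (T : Type) (t : Topological T) : Prop :=
  forall A : set (space t), open A.

Definition topology_join (T : choiceType) (s t : Topological T) :
    Topological T :=
  Topological.class (sup_topology (fun b : bool => if b then s else t)).

Definition transversal_topologies (T : choiceType) (s t : Topological T) : Prop :=
  [/\ ~ discrete s, ~ discrete t & discrete (topology_join s t)].

Definition paratopological (G : groupType) (t : Topological G) : Prop :=
  continuous (fun p : space t * space t => (p.1 : G) * (p.2 : G) : space t).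

Definition centralizer (H : groupType) (A : set H) : set H :=
  [set x | forall y, A y -> commute x y].

Definition set_mul (H : groupType) (A B : set H) : set H :=
  [set x * y | x in A & y in B].

Definition subspace_topology (H : choiceType) (P : {pred H})
    (G : subChoiceType P) (t : Topological H) : Topological G :=
  Topological.class (initial_topology (\val : G -> space t)).

(* Main.v *)
(** Give [H] the topology in which the sets [x U], with [U] a
    [sigma]-neighbourhood of [1] in [G], form a base at [x].  Since
    [H = G c_H(G)], every element of [H] conjugates [G] the way some element of
    [G] does, hence [sigma]-continuously, and multiplication is jointly
    continuous.  If [U] and [W] are neighbourhoods of [1] in [sigma] and [tau]
    meeting only in [1], then [x U] and [x W] meet only in [x]; in both cases
    such [U] and [W] exist because [sigma] and the trace of [tau] on [G] jointly
    generate the discrete topology. *)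
Require Import Defs.
From HB Require Import structures.
From mathcomp Require Import all_boot.
From mathcomp Require Import all_classical all_reals topology.

Set Implicit Arguments.
Unset Strict Implicit.
Unset Printing Implicit Defensive.

Local Open Scope classical_set_scope.
Local Open Scope group_scope.

Definition nbhd (T : Type) (t : Topological T) (x : T) : set_system T :=
  nbhs (x : space t).

Section Nbhd.
Variables (T : choiceType).
Implicit Types (s t : Topological T) (x : T).

Lemma discrete_nbhd1 t : discrete t <-> forall x, nbhd t x [set x].
Proof.
split=> [td x|tn A]; first exact: (@open_nbhs_nbhs (space t)).
rewrite openE => x Ax; apply: (filterS _ (tn x)).
by move=> _ ->.
Qed.

Lemma discrete_topology_joinP s t : discrete (topology_join s t) <->
  forall x, exists U V, [/\ nbhd s x U, nbhd t x V & U `&` V `<=` [set x]].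
Proof.
pose Tc b := if b then s else t.
rewrite discrete_nbhd1; split=> [jd x|st x].
  (* The filter [F] converges to [x] for both [s] and [t], hence for their supremum; so [[set x]], a
     neighbourhood of [x] there, belongs to [F]. *)
  pose F := filter_from [set p : set T * set T | nbhd s x p.1 /\ nbhd t x p.2]
    (fun p => p.1 `&` p.2).
  have FF : Filter F.
    apply: filter_from_filter; first by exists (setT, setT); split; exact: filterT.
    move=> [U V] [U' V'] [/= sU tV] [/= sU' tV']; exists (U `&` U', V `&` V').
      by split; exact: filterI.
    by rewrite setIACA.
  have /(_ _ (jd x)) : F --> (x : sup_topology Tc).
    apply/cvg_sup => -[] A xA.
      by exists (A, setT); rewrite /= ?setIT //; split => //; exact: filterT.
    by exists (setT, A); rewrite /= ?setTI //; split => //; exact: filterT.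
  by case=> -[U V] [sU tV] UV; exists U, V.
have [U [V [sU tV UV]]] := st x.
have /cvg_sup nb := @cvg_id _ (nbhs (x : sup_topology Tc)).
apply: (filterS UV); apply: filterI; first exact: (nb true).
exact: (nb false).
Qed.

End Nbhd.

Lemma nbhd_subspace_topology (H : choiceType) (P : {pred H})
    (G : subChoiceType P) (t : Topological H) (g : G) (A : set G) :
  nbhd (subspace_topology G t) g A ->
  exists2 B, nbhd t (\val g) B & \val @^-1` B `<=` A.
Proof.
case=> _ [[B Bo <-] Bg] BA; exists B => //.
exact: (@open_nbhs_nbhs (space t)).
Qed.

Lemma paratopologicalP (G : groupType) (t : Topological G) :
  paratopological t <-> forall x y A, nbhd t (x * y) A ->
    exists U V, [/\ nbhd t x U, nbhd t y V &
      forall u v, U u -> V v -> A (u * v)].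
Proof.
split=> [tc x y A /(tc (x, y))[[U V] [/= xU yV] UV]|tc [x y] A /tc].
  by exists U, V; split=> // u v Uu Vv; exact: (UV (u, v)).
by move=> [U [V [xU yV UV]]]; exists (U, V) => // -[u v] [/= Uu Vv]; exact: UV.
Qed.

Section Extension.
Variables (H : groupType) (P : {pred H}) (G : subGroupType P).
Variable sigma : Topological G.

Definition extension : Type := H.

HB.instance Definition _ := Choice.copy extension H.

(** Openness is tested along left cosets of [G]. This gives a topology for any [sigma]; continuity
    of multiplication enters only when neighbourhoods are computed. *)
Definition extension_open : set_system H :=
  [set A | forall x, A x -> nbhd sigma 1 [set g | A (x * \val g)]].

Lemma extension_openT : extension_open [set: H].
Proof. by move=> x _; exact: filterT. Qed.

Lemma extension_openI : setI_closed extension_open.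
Proof. by move=> A B Ao Bo x [/Ao Ax /Bo]; exact: filterI. Qed.

Lemma extension_open_bigU (I : Type) (f : I -> set H) :
  (forall i, extension_open (f i)) -> extension_open (\bigcup_i f i).
Proof. by move=> fo x [i _ /fo]; apply: filterS => g fg; exists i. Qed.

HB.instance Definition _ := isOpenTopological.Build extension
  extension_openT extension_openI extension_open_bigU.

Definition extension_topology : Topological H := Topological.class extension.

Hypothesis sigmaP : paratopological sigma.

Lemma nbhd_extension_topology (x : H) (A : set H) :
  nbhd extension_topology x A <-> nbhd sigma 1 [set g | A (x * \val g)].
Proof.
split=> [[B [Bo Bx] BA]|xA]; first by apply: filterS (Bo x Bx) => g /BA.
(* The candidate for the interior of [A]. It is open because, by continuity at [1 * 1 = 1], a
   neighbourhood of [1] contains a product [U V] of two others: each [y u] with [u] in [U] then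
   stays in the set. *)
exists [set y | nbhd sigma 1 [set g | A (y * \val g)]].
split=> // [y yA|y /(@nbhs_singleton (space sigma)) /=]; last first.
  by rewrite val1 mulg1.
have : nbhd sigma (1 * 1) [set g | A (y * \val g)] by rewrite mulg1.
case/(paratopologicalP _).1 => // U [V [U1 V1 UV]].
apply: filterS U1 => u Uu; apply: filterS V1 => v Vv /=.
by rewrite -mulgA -valM; exact: UV.
Qed.

Lemma discrete_extension_topology : discrete extension_topology -> discrete sigma.
Proof.
move=> /discrete_nbhd1 ed; apply/discrete_nbhd1 => g.
have /nbhd_extension_topology g1 := ed 1.
(* Isolation of [1] is carried to [g] by left translation by [g^-1], which is continuous without
   continuity of inversion. *)
have : nbhd sigma (g^-1 * g) [set 1].
  rewrite mulVg; apply: filterS g1 => h /=; rewrite mul1g -(val1 G).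
  exact: val_inj.
case/(paratopologicalP _).1 => // U [V [Ug Vg UV]].
apply: filterS Vg => h /(UV _ _ (nbhs_singleton Ug)) /= gh.
by rewrite -[h](mulVKg g) gh mulg1.
Qed.

Lemma paratopological_extension_topology :
  set_mul [set` P] (centralizer [set` P]) = [set: H] ->
  paratopological extension_topology.
Proof.
move=> GC; apply/paratopologicalP => x y A /nbhd_extension_topology xyA.
have [a Pa [c cC acy]] : set_mul [set` P] (centralizer [set` P]) y by rewrite GC.
pose b : G := Sub a Pa.
have valbV : \val b^-1 = a^-1 by rewrite gmulfV; congr _^-1; exact: SubK.
(* As [c] commutes with [G], conjugation by [y = a c] acts on [G] as conjugation by [a], an element
   of [G]. *)
have conj_y (g : G) : \val g * y = y * \val (b^-1 * g * b).
  have cg : commute c (\val (b^-1 * g * b)) by apply: cC; exact: valP.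
  rewrite -acy -mulgA cg mulgA !valM valbV SubK mulgA; congr (_ * c).
  by rewrite !mulgA mulgV mul1g.
have {xyA} : nbhd sigma (1 * 1) [set g | A (x * y * \val g)] by rewrite mulg1.
case/(paratopologicalP _).1 => // U [V [U1 V1 UV]].
(* Two uses of continuity yield a neighbourhood [W] of [1] with [b^-1 W b] inside [U]; then
   [x g y h = x y (b^-1 g b) h] lies in [A] for [g] in [W] and [h] in [V]. *)
have {U1} : nbhd sigma (b^-1 * 1 * b) U by rewrite mulg1 mulVg.
case/(paratopologicalP _).1 => // U' [B [U'b Bb UB]].
case/(paratopologicalP _).1: U'b => // B' [W [B'b W1 BW]].
exists [set x * \val g | g in W], [set y * \val g | g in V]; split.
- by apply/nbhd_extension_topology; apply: filterS W1 => g Wg; exists g.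
- by apply/nbhd_extension_topology; apply: filterS V1 => g Vg; exists g.
move=> _ _ [g Wg <-] [h Vh <-].
rewrite mulgA -(mulgA x) conj_y mulgA -mulgA -valM.
apply: UV => //; apply: UB; last exact: nbhs_singleton Bb.
by apply: BW => //; exact: nbhs_singleton B'b.
Qed.

Lemma discrete_join_extension_topology (tau : Topological H) :
  paratopological tau ->
  discrete (topology_join sigma (subspace_topology G tau)) ->
  discrete (topology_join extension_topology tau).
Proof.
move=> tauP /discrete_topology_joinP /(_ 1)[U [W0 [U1 W01 UW0]]].
have [W W1 WW0] := nbhd_subspace_topology W01.
apply/discrete_topology_joinP => x.
(* Continuity of translation by [x^-1] gives a [tau]-neighbourhood [V] of [x] inside [x W]. *)
have : nbhd tau (x^-1 * x) W by rewrite mulVg -(val1 G).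
case/(paratopologicalP _).1 => // X [V [Xx Vx XV]].
exists [set x * \val g | g in U], V; split => //.
  by apply/nbhd_extension_topology; apply: filterS U1 => g Ug; exists g.
move=> _ [[g Ug <-] /(XV _ _ (nbhs_singleton Xx))]; rewrite mulKg => Wg /=.
by have /= -> := UW0 g (conj Ug (WW0 g Wg)); rewrite val1 mulg1.
Qed.

End Extension.

Theorem theorem4p11 (H : groupType) (tau : Topological H)
    (P : {pred H}) (G : subGroupType P) :
  paratopological tau -> ~ discrete tau ->
  infinite_set [set: G] ->
  set_mul [set` P] (centralizer [set` P]) = [set: H] ->
  ((exists sigma : Topological G,
      paratopological sigma /\ transversal_topologies sigma (subspace_topology G tau))
   \/
   (discrete (subspace_topology G tau) /\
    exists sigma : Topological G,
      paratopological sigma /\ ~ discrete sigma)) ->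
  exists sigma : Topological H,
    paratopological sigma /\ transversal_topologies sigma tau.
Proof.
move=> tauP tau_nd _ GC cases.
have [sigma [sigmaP sigma_nd join_d]] : exists sigma : Topological G,
    [/\ paratopological sigma, ~ discrete sigma &
        discrete (topology_join sigma (subspace_topology G tau))].
  case: cases => [[sigma [sigmaP [nd _ jd]]]|[Gd [sigma [sigmaP nd]]]].
    by exists sigma.
  (* When the trace of [tau] is discrete, its join with any [sigma] is discrete. *)
  exists sigma; split=> //; apply/discrete_topology_joinP => g.
  exists setT, [set g]; split; [exact: filterT| |by move=> h []].
  exact: (discrete_nbhd1 _).1.
exists (extension_topology sigma); split.
  exact: paratopological_extension_topology.
split=> //; last exact: discrete_join_extension_topology.
by move=> /(discrete_extension_topology sigmaP).
Qed.
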